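(* Let $A'=A'(R,\sigma,t,\mu)$ be a twisted generalized Weyl construction of rank $n=2$, where $R$ is a domain, with the following two properties. (P1) For any positive integer $k$ and any $r\in R$ the following implication holds: $$r\cdot(\sigma_1\sigma_2)^k(t_1)\cdot(\sigma_1\sigma_2)^{k-1}(t_1)\cdots(\sigma_1\sigma_2)(t_1)\in R\cdot\sigma_1(t_1)\ \Longrightarrow\ r\in R\cdot\sigma_1(t_1).$$ (P2) The ideal $I$ of $A'$ contains elements of the form $$s_1:=X_2X_1^2-\xi_1X_1X_2X_1-\xi_2X_1^2X_2,\qquad s_2:=X_2^2X_1-\eta_1X_2X_1X_2-\eta_2X_1X_2^2,$$ where $\xi_1,\xi_2,\eta_1,\eta_2$ are nonzero elements of $\mathbb{K}$. Then $I$ is generated (as a two-sided ideal of $A'$) by $s_1,s_2,s_1^\ast,s_2^\ast$.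
   Context: $\mathbb{K}$ is an arbitrary field; all algebras are associative unital $\mathbb{K}$-algebras. Data: a positive integer $n$ (the rank); a commutative $\mathbb{K}$-algebra $R$; an $n$-tuple $\sigma=(\sigma_1,\ldots,\sigma_n)$ of pairwise commuting $\mathbb{K}$-algebra automorphisms of $R$; an $n$-tuple $t=(t_1,\ldots,t_n)$ of nonzero elements of $R$; and a symmetric matrix $\mu=(\mu_{ij})_{i,j=1}^n$ with off-diagonal entries in $\mathbb{K}\setminus\{0\}$ (diagonal entries undefined and irrelevant). It is required that $t_it_j=\mu_{ij}\mu_{ji}\sigma_j^{-1}(t_i)\sigma_i^{-1}(t_j)$ for all $i\neq j$. The twisted generalized Weyl construction (TGWC) $A'=A'(R,\sigma,t,\mu)$ is the algebra obtained from $R$ by adjoining noncommuting generators $X_1,\ldots,X_n,Y_1,\ldots,Y_n$ with defining relations, for all $i\neq j$ and $r\in R$: $X_ir=\sigma_i(r)X_i$, $Y_ir=\sigma_i^{-1}(r)Y_i$, $Y_iX_i=t_i$, $X_iY_i=\sigma_i(t_i)$, $X_iY_j=\mu_{ij}Y_jX_i$. It is $\mathbb{Z}^n$-graded by $\deg X_i=e_i$, $\deg Y_i=-e_i$, $\deg r=0$ for $r\in R$, where $(e_i)$ is the standard basis of $\mathbb{Z}^n$. Standing identification: the natural map $R\to A'$ is injective with image $A'_0$, so $A'_0=R$. $I\subseteq A'$ denotes the unique maximal graded two-sided ideal with $I\cap R=0$ (the sum of all graded ideals intersecting $R$ trivially). Since $\mu$ is symmetric, $A'$ carries a $\mathbb{K}$-linear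 anti-involution $\ast$ ($a^{\ast\ast}=a$, $(ab)^\ast=b^\ast a^\ast$) determined by $X_i^\ast=Y_i$, $Y_i^\ast=X_i$, $r^\ast=r$ for $r\in R$. *)

(* Defs.v *)
From HB Require Import structures.
From mathcomp Require Import all_boot all_algebra.
From mathcomp Require Import generic_quotient.
From mathcomp Require Import boolp classical_sets.

Set Implicit Arguments.
Unset Strict Implicit.
Unset Printing Implicit Defensive.

Import GRing.Theory.
Local Open Scope ring_scope.
Local Open Scope classical_set_scope.
Local Open Scope quotient_scope.

(* The automorphism sigma_i is a K-algebra endomorphism given together with   *)
(* its inverse sigmaV i. The diagonal entries of mu are never used.           *)
Record tgw_datum (K : fieldType) (R : comAlgType K) (n : nat) := TGWDatum {
  tgw_sigma : 'I_n -> {lrmorphism R -> R};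
  tgw_sigmaV : 'I_n -> {lrmorphism R -> R};
  tgw_t : 'I_n -> R;
  tgw_mu : 'I_n -> 'I_n -> K;
  tgw_sigmaK : forall i, cancel (tgw_sigma i) (tgw_sigmaV i);
  tgw_sigmaVK : forall i, cancel (tgw_sigmaV i) (tgw_sigma i);
  tgw_sigmaC : forall i j r,
    tgw_sigma i (tgw_sigma j r) = tgw_sigma j (tgw_sigma i r);
  tgw_t_neq0 : forall i, tgw_t i != 0;
  tgw_mu_sym : forall i j, i != j -> tgw_mu i j = tgw_mu j i;
  tgw_mu_neq0 : forall i j, i != j -> tgw_mu i j != 0;
  tgw_consistent : forall i j, i != j ->
    tgw_t i * tgw_t j =
      (tgw_mu i j * tgw_mu j i)
        *: (tgw_sigmaV j (tgw_t i) * tgw_sigmaV i (tgw_t j)) }.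

Section TGWC.

Context {K : fieldType} {R : comAlgType K} {n : nat} (D : tgw_datum R n).

Local Notation sigma := (tgw_sigma D).
Local Notation sigmaV := (tgw_sigmaV D).
Local Notation t := (tgw_t D).
Local Notation mu := (tgw_mu D).

(* The algebra A' is the quotient of the formal noncommutative expressions in *)
(* R, X_i, Y_i by the least congruence containing the axioms of K-algebras,   *)
(* the structure of R and the defining relations; the opposite of a is        *)
(* (-1) * a, and c in K acts as multiplication by c%:A in R.                  *)
Inductive tgw_term : Type :=
| TCoef of R
| TX of 'I_n
| TY of 'I_n
| TAdd of tgw_term & tgw_term
| TMul of tgw_term & tgw_term.

Inductive tgw_eqv : tgw_term -> tgw_term -> Prop :=
| eqv_refl a : tgw_eqv a a
| eqv_sym a b : tgw_eqv a b -> tgw_eqv b a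
| eqv_trans a b c : tgw_eqv a b -> tgw_eqv b c -> tgw_eqv a c
| eqv_add a a' b b' :
    tgw_eqv a a' -> tgw_eqv b b' -> tgw_eqv (TAdd a b) (TAdd a' b')
| eqv_mul a a' b b' :
    tgw_eqv a a' -> tgw_eqv b b' -> tgw_eqv (TMul a b) (TMul a' b')
| eqv_addA a b c : tgw_eqv (TAdd a (TAdd b c)) (TAdd (TAdd a b) c)
| eqv_addC a b : tgw_eqv (TAdd a b) (TAdd b a)
| eqv_add0 a : tgw_eqv (TAdd (TCoef 0) a) a
| eqv_addN a : tgw_eqv (TAdd (TMul (TCoef (-1)) a) a) (TCoef 0)
| eqv_mulA a b c : tgw_eqv (TMul a (TMul b c)) (TMul (TMul a b) c)
| eqv_mul1l a : tgw_eqv (TMul (TCoef 1) a) a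
| eqv_mul1r a : tgw_eqv (TMul a (TCoef 1)) a
| eqv_mulDl a b c : tgw_eqv (TMul (TAdd a b) c) (TAdd (TMul a c) (TMul b c))
| eqv_mulDr a b c : tgw_eqv (TMul a (TAdd b c)) (TAdd (TMul a b) (TMul a c))
| eqv_scal (k : K) a : tgw_eqv (TMul (TCoef k%:A) a) (TMul a (TCoef k%:A))
| eqv_coefD r s : tgw_eqv (TCoef (r + s)) (TAdd (TCoef r) (TCoef s))
| eqv_coefM r s : tgw_eqv (TCoef (r * s)) (TMul (TCoef r) (TCoef s))
| eqv_Xr i r : tgw_eqv (TMul (TX i) (TCoef r)) (TMul (TCoef (sigma i r)) (TX i))
| eqv_Yr i r :
    tgw_eqv (TMul (TY i) (TCoef r)) (TMul (TCoef (sigmaV i r)) (TY i))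
| eqv_YX i : tgw_eqv (TMul (TY i) (TX i)) (TCoef (t i))
| eqv_XY i : tgw_eqv (TMul (TX i) (TY i)) (TCoef (sigma i (t i)))
| eqv_XYmu i j : i != j ->
    tgw_eqv (TMul (TX i) (TY j)) (TMul (TCoef (mu i j)%:A) (TMul (TY j) (TX i))).

HB.instance Definition _ := gen_eqMixin tgw_term.
HB.instance Definition _ := gen_choiceMixin tgw_term.

Definition tgw_eqvb (a b : tgw_term) : bool := `[< tgw_eqv a b >].

Lemma tgw_eqvb_refl : reflexive tgw_eqvb.
Proof. by move=> a; apply/asboolP/eqv_refl. Qed.

Lemma tgw_eqvb_sym : symmetric tgw_eqvb.
Proof. by move=> a b; apply/asboolP/asboolP; apply: eqv_sym. Qed.

Lemma tgw_eqvb_trans : transitive tgw_eqvb.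
Proof.
by move=> b a c /asboolP ab /asboolP bc; apply/asboolP/(eqv_trans ab bc).
Qed.

Canonical tgw_equiv :=
  EquivRel tgw_eqvb tgw_eqvb_refl tgw_eqvb_sym tgw_eqvb_trans.

Definition tgwc : Type := {eq_quot tgw_equiv}.

HB.instance Definition _ := Choice.on tgwc.

Definition tgw_cls (a : tgw_term) : tgwc := \pi_({eq_quot tgw_equiv}) a.
Definition tgw_repr (x : tgwc) : tgw_term :=
  repr (x : {eq_quot tgw_equiv}).

Lemma tgw_clsP a b : tgw_cls a = tgw_cls b <-> tgw_eqv a b.
Proof.
by split=> [/eqquotP/asboolP|ab] //; apply/eqquotP/asboolP.
Qed.

Lemma tgw_reprK : cancel tgw_repr tgw_cls.
Proof. by move=> x; apply: reprK. Qed.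

Lemma tgw_repr_cls a : tgw_eqv (tgw_repr (tgw_cls a)) a.
Proof. by apply/tgw_clsP; rewrite tgw_reprK. Qed.

Lemma tgwcW (P : tgwc -> Prop) : (forall a, P (tgw_cls a)) -> forall x, P x.
Proof. by move=> Pcls x; rewrite -(tgw_reprK x). Qed.

Definition tgw_zero : tgwc := tgw_cls (TCoef 0).
Definition tgw_one : tgwc := tgw_cls (TCoef 1).
Definition tgw_add (x y : tgwc) : tgwc :=
  tgw_cls (TAdd (tgw_repr x) (tgw_repr y)).
Definition tgw_mul (x y : tgwc) : tgwc :=
  tgw_cls (TMul (tgw_repr x) (tgw_repr y)).
Definition tgw_opp (x : tgwc) : tgwc := tgw_mul (tgw_cls (TCoef (-1))) x.

Lemma tgw_clsD a b : tgw_add (tgw_cls a) (tgw_cls b) = tgw_cls (TAdd a b).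
Proof. by apply/tgw_clsP/eqv_add; apply: tgw_repr_cls. Qed.

Lemma tgw_clsM a b : tgw_mul (tgw_cls a) (tgw_cls b) = tgw_cls (TMul a b).
Proof. by apply/tgw_clsP/eqv_mul; apply: tgw_repr_cls. Qed.

Lemma tgw_addA : associative tgw_add.
Proof.
do 3![elim/tgwcW=> ?]; rewrite !tgw_clsD; apply/tgw_clsP/eqv_addA.
Qed.

Lemma tgw_addC : commutative tgw_add.
Proof. do 2![elim/tgwcW=> ?]; rewrite !tgw_clsD; apply/tgw_clsP/eqv_addC. Qed.

Lemma tgw_add0 : left_id tgw_zero tgw_add.
Proof. elim/tgwcW=> ?; rewrite tgw_clsD; apply/tgw_clsP/eqv_add0. Qed.

Lemma tgw_addN : left_inverse tgw_zero tgw_opp tgw_add.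
Proof.
elim/tgwcW=> ?; rewrite /tgw_opp tgw_clsM tgw_clsD; apply/tgw_clsP/eqv_addN.
Qed.

Lemma tgw_mulA : associative tgw_mul.
Proof.
do 3![elim/tgwcW=> ?]; rewrite !tgw_clsM; apply/tgw_clsP/eqv_mulA.
Qed.

Lemma tgw_mul1l : left_id tgw_one tgw_mul.
Proof. elim/tgwcW=> ?; rewrite tgw_clsM; apply/tgw_clsP/eqv_mul1l. Qed.

Lemma tgw_mul1r : right_id tgw_one tgw_mul.
Proof. elim/tgwcW=> ?; rewrite tgw_clsM; apply/tgw_clsP/eqv_mul1r. Qed.

Lemma tgw_mulDl : left_distributive tgw_mul tgw_add.
Proof.
do 3![elim/tgwcW=> ?]; rewrite !(tgw_clsM, tgw_clsD).
apply/tgw_clsP/eqv_mulDl.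
Qed.

Lemma tgw_mulDr : right_distributive tgw_mul tgw_add.
Proof.
do 3![elim/tgwcW=> ?]; rewrite !(tgw_clsM, tgw_clsD).
apply/tgw_clsP/eqv_mulDr.
Qed.

(* A possibly trivial ring: for an arbitrary datum of rank at least 3 the     *)
(* relations may collapse A' to 0.                                            *)
HB.instance Definition _ := GRing.isPzRing.Build tgwc
  tgw_addA tgw_addC tgw_add0 tgw_addN
  tgw_mulA tgw_mul1l tgw_mul1r tgw_mulDl tgw_mulDr.

Definition tgwR (r : R) : tgwc := tgw_cls (TCoef r).
Definition tgwX (i : 'I_n) : tgwc := tgw_cls (TX i).
Definition tgwY (i : 'I_n) : tgwc := tgw_cls (TY i).

Lemma tgw_clsDE a b : tgw_cls (TAdd a b) = tgw_cls a + tgw_cls b.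
Proof. by rewrite -tgw_clsD. Qed.

Lemma tgw_clsME a b : tgw_cls (TMul a b) = tgw_cls a * tgw_cls b.
Proof. by rewrite -tgw_clsM. Qed.

Lemma tgwR_zmod_morphism : zmod_morphism tgwR.
Proof.
move=> r s; apply/(@addIr _ (tgwR s)); rewrite subrK -tgw_clsDE.
by apply/tgw_clsP/eqv_sym; rewrite -{1}[r](subrK s); apply: eqv_coefD.
Qed.

Lemma tgwR_monoid_morphism : monoid_morphism tgwR.
Proof.
by split=> // r s; rewrite -tgw_clsME; apply/tgw_clsP/eqv_coefM.
Qed.

HB.instance Definition _ :=
  GRing.isZmodMorphism.Build R tgwc tgwR tgwR_zmod_morphism.
HB.instance Definition _ :=
  GRing.isMonoidMorphism.Build R tgwc tgwR tgwR_monoid_morphism.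

Definition tgw_scale (k : K) (x : tgwc) : tgwc := tgwR k%:A * x.

Lemma tgw_scalerA a b v : tgw_scale a (tgw_scale b v) = tgw_scale (a * b) v.
Proof. by rewrite /tgw_scale mulrA -rmorphM /= -scalerAl mul1r scalerA. Qed.

Lemma tgw_scale1r : left_id 1 tgw_scale.
Proof. by move=> x; rewrite /tgw_scale scale1r rmorph1 mul1r. Qed.

Lemma tgw_scalerDr : right_distributive tgw_scale +%R.
Proof. by move=> k x y; apply: mulrDr. Qed.

Lemma tgw_scalerDl v : {morph tgw_scale^~ v : a b / a + b}.
Proof. by move=> a b; rewrite /tgw_scale scalerDl rmorphD mulrDl. Qed.

HB.instance Definition _ := GRing.Zmodule_isLmodule.Build K tgwc
  tgw_scalerA tgw_scale1r tgw_scalerDr tgw_scalerDl.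

Lemma tgw_scaleE (k : K) (x : tgwc) : k *: x = tgwR k%:A * x.
Proof. by []. Qed.

Lemma tgw_scaleAl (k : K) (x y : tgwc) : k *: (x * y) = (k *: x) * y.
Proof. by rewrite !tgw_scaleE mulrA. Qed.

Lemma tgw_scaleAr (k : K) (x y : tgwc) : k *: (x * y) = x * (k *: y).
Proof.
rewrite !tgw_scaleE !mulrA; congr (_ * y).
elim/tgwcW: x => a; rewrite -!tgw_clsME; exact/tgw_clsP/eqv_scal.
Qed.

Lemma tgwRZ (k : K) r : tgwR (k *: r) = k *: tgwR r.
Proof. by rewrite tgw_scaleE -rmorphM /= -scalerAl mul1r. Qed.

Lemma tgwXr i r : tgwX i * tgwR r = tgwR (sigma i r) * tgwX i.
Proof. by rewrite -!tgw_clsME; apply/tgw_clsP/eqv_Xr. Qed.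

Lemma tgwYr i r : tgwY i * tgwR r = tgwR (sigmaV i r) * tgwY i.
Proof. by rewrite -!tgw_clsME; apply/tgw_clsP/eqv_Yr. Qed.

Lemma tgwYX i : tgwY i * tgwX i = tgwR (t i).
Proof. by rewrite -!tgw_clsME; apply/tgw_clsP/eqv_YX. Qed.

Lemma tgwXY i : tgwX i * tgwY i = tgwR (sigma i (t i)).
Proof. by rewrite -!tgw_clsME; apply/tgw_clsP/eqv_XY. Qed.

Lemma tgwXYmu i j : i != j -> tgwX i * tgwY j = mu i j *: (tgwY j * tgwX i).
Proof.
by move=> ij; have /tgw_clsP := eqv_XYmu ij; rewrite !tgw_clsME.
Qed.

Lemma tgwc_ind (P : tgwc -> Prop) :
    (forall r, P (tgwR r)) -> (forall i, P (tgwX i)) -> (forall i, P (tgwY i)) ->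
    (forall x y, P x -> P y -> P (x + y)) ->
    (forall x y, P x -> P y -> P (x * y)) ->
  forall x, P x.
Proof.
move=> PR PX PY PD PM; elim/tgwcW; elim=> //= a Pa b Pb.
  by rewrite tgw_clsDE; apply: PD.
by rewrite tgw_clsME; apply: PM.
Qed.

Lemma tgwc_universal (B : algType K) (f : {lrmorphism R -> B})
    (x y : 'I_n -> B) :
    (forall i r, x i * f r = f (sigma i r) * x i) ->
    (forall i r, y i * f r = f (sigmaV i r) * y i) ->
    (forall i, y i * x i = f (t i)) ->
    (forall i, x i * y i = f (sigma i (t i))) ->
    (forall i j, i != j -> x i * y j = mu i j *: (y j * x i)) ->
  exists! g : tgwc -> B,
    [/\ zmod_morphism g, monoid_morphism g, forall r, g (tgwR r) = f r,
        forall i, g (tgwX i) = x i & forall i, g (tgwY i) = y i].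
Proof.
move=> xr yr yx xy xymu.
pose ev := fix ev a := match a with
  | TCoef r => f r | TX i => x i | TY i => y i
  | TAdd a b => ev a + ev b | TMul a b => ev a * ev b end.
have evP a b : tgw_eqv a b -> ev a = ev b.
  elim=> {a b} //=.
  - by move=> a b c _ -> _ ->.
  - by move=> a a' b b' _ -> _ ->.
  - by move=> a a' b b' _ -> _ ->.
  - by move=> a b c; rewrite addrA.
  - by move=> a b; rewrite addrC.
  - by move=> a; rewrite rmorph0 add0r.
  - by move=> a; rewrite rmorphN1 mulN1r addNr rmorph0.
  - by move=> a b c; rewrite mulrA.
  - by move=> a; rewrite rmorph1 mul1r.
  - by move=> a; rewrite rmorph1 mulr1.
  - by move=> a b c; rewrite mulrDl.
  - by move=> a b c; rewrite mulrDr.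
  - by move=> k a; rewrite linearZ rmorph1 /= mulr_algl mulr_algr.
  - by move=> r s; rewrite rmorphD.
  - by move=> r s; rewrite rmorphM.
  - by move=> i j ij; rewrite xymu // linearZ rmorph1 /= mulr_algl.
have evc a : ev (tgw_repr (tgw_cls a)) = ev a by apply/evP/tgw_repr_cls.
have evD u v : ev (tgw_repr (u + v)) = ev (tgw_repr u) + ev (tgw_repr v).
  by elim/tgwcW: u => u; elim/tgwcW: v => v; rewrite -tgw_clsDE !evc.
exists (fun z => ev (tgw_repr z)); split.
  split=> [u v||r|i|i]; [ | |exact: evc|exact: evc|exact: evc].
  - by apply/eqP; rewrite eq_sym subr_eq -evD subrK.
  - split=> [|u v]; first by rewrite evc /= rmorph1.
    by elim/tgwcW: u => u; elim/tgwcW: v => v; rewrite -tgw_clsME !evc.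
move=> g [gB [g1 gM] gR gX gY]; apply/funext; elim/tgwc_ind.
- by move=> r; rewrite evc gR.
- by move=> i; rewrite evc gX.
- by move=> i; rewrite evc gY.
- have g0 : g 0 = 0 by rewrite -(subrr 0) gB subrr.
  have gN u : g (- u) = - g u by rewrite -sub0r gB g0 sub0r.
  move=> u v; elim/tgwcW: u => u; elim/tgwcW: v => v.
  rewrite -tgw_clsDE !evc /= => -> ->.
  by rewrite tgw_clsDE -[tgw_cls v in RHS]opprK gB gN opprK.
- move=> u v; elim/tgwcW: u => u; elim/tgwcW: v => v.
  by rewrite -tgw_clsME !evc /= => -> ->; rewrite tgw_clsME gM.
Qed.

(* tgw_homog d a : a lies in the component of degree d of the Z^n-grading.    *)
Inductive tgw_homog : 'rV[int]_n -> tgwc -> Prop :=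
| homog_R r : tgw_homog 0 (tgwR r)
| homog_X i : tgw_homog (delta_mx 0 i) (tgwX i)
| homog_Y i : tgw_homog (- delta_mx 0 i) (tgwY i)
| homog_zero d : tgw_homog d 0
| homog_add d a b : tgw_homog d a -> tgw_homog d b -> tgw_homog d (a + b)
| homog_mul d e a b :
    tgw_homog d a -> tgw_homog e b -> tgw_homog (d + e) (a * b).

Definition tgw_ideal (J : set tgwc) : Prop :=
  [/\ J 0, forall a b, J a -> J b -> J (a + b),
      forall a b, J b -> J (a * b) & forall a b, J a -> J (a * b)].

(* Every element of J is a sum of homogeneous elements of J.                  *)
Definition tgw_graded (J : set tgwc) : Prop :=
  forall a, J a -> exists s : seq ('rV[int]_n * tgwc),
    (forall p, p \in s -> tgw_homog p.1 p.2 /\ J p.2) /\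
    a = \sum_(p <- s) p.2.

(* The sum of all graded two-sided ideals which intersect R trivially.        *)
Definition tgw_I : set tgwc :=
  [set a | exists s : seq tgwc,
    (forall b, b \in s -> exists J : set tgwc,
       [/\ tgw_ideal J, tgw_graded J, J `&` range tgwR = [set 0] & J b]) /\
    a = \sum_(b <- s) b].

Definition tgw_ideal_gen (S : set tgwc) : set tgwc := smallest tgw_ideal S.

Fixpoint tgw_tstar (a : tgw_term) : tgw_term :=
  match a with
  | TCoef r => TCoef r
  | TX i => TY i
  | TY i => TX i
  | TAdd a b => TAdd (tgw_tstar a) (tgw_tstar b)
  | TMul a b => TMul (tgw_tstar b) (tgw_tstar a)
  end.

Definition tgw_star (x : tgwc) : tgwc := tgw_cls (tgw_tstar (tgw_repr x)).

Lemma tgw_tstar_eqv a b :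
  tgw_eqv a b -> tgw_cls (tgw_tstar a) = tgw_cls (tgw_tstar b).
Proof.
elim=> {a b} //=.
- by move=> a b c _ -> _ ->.
- by move=> a a' b b' _ ea _ eb; rewrite !tgw_clsDE ea eb.
- by move=> a a' b b' _ ea _ eb; rewrite !tgw_clsME ea eb.
- by move=> a b c; rewrite !tgw_clsDE addrA.
- by move=> a b; rewrite !tgw_clsDE addrC.
- by move=> a; apply/tgw_clsP/eqv_add0.
- move=> a; rewrite tgw_clsDE tgw_clsME -/(tgwR _) rmorphN1 mulrN1 addNr.
  by rewrite -/(tgwR 0) rmorph0.
- by move=> a b c; rewrite !tgw_clsME mulrA.
- by move=> a; apply/tgw_clsP/eqv_mul1r.
- by move=> a; apply/tgw_clsP/eqv_mul1l.
- by move=> a b c; apply/tgw_clsP/eqv_mulDr.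
- by move=> a b c; apply/tgw_clsP/eqv_mulDl.
- by move=> k a; apply/esym/tgw_clsP/eqv_scal.
- by move=> r s; apply/tgw_clsP/eqv_coefD.
- by move=> r s; rewrite mulrC; apply/tgw_clsP/eqv_coefM.
- by move=> i r; rewrite !tgw_clsME -!/(tgwR _) -!/(tgwY _) tgwYr tgw_sigmaK.
- by move=> i r; rewrite !tgw_clsME -!/(tgwR _) -!/(tgwX _) tgwXr tgw_sigmaVK.
- by move=> i; apply/tgw_clsP/eqv_YX.
- by move=> i; apply/tgw_clsP/eqv_XY.
- move=> i j ij; rewrite !tgw_clsME -!/(tgwR _) -!/(tgwY _) -!/(tgwX _).
  rewrite tgwXYmu 1?eq_sym // tgw_mu_sym 1?eq_sym // tgw_scaleE.
  rewrite -!tgw_clsME; exact/tgw_clsP/eqv_scal.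
Qed.

Lemma tgw_star_cls a : tgw_star (tgw_cls a) = tgw_cls (tgw_tstar a).
Proof. exact/tgw_tstar_eqv/tgw_repr_cls. Qed.

Lemma tgw_starR r : tgw_star (tgwR r) = tgwR r.
Proof. exact: tgw_star_cls. Qed.

Lemma tgw_starX i : tgw_star (tgwX i) = tgwY i.
Proof. exact: tgw_star_cls. Qed.

Lemma tgw_starY i : tgw_star (tgwY i) = tgwX i.
Proof. exact: tgw_star_cls. Qed.

Lemma tgw_starD : {morph tgw_star : a b / a + b}.
Proof.
by do 2![elim/tgwcW=> ?]; rewrite -tgw_clsDE !tgw_star_cls /= tgw_clsDE.
Qed.

Lemma tgw_starM a b : tgw_star (a * b) = tgw_star b * tgw_star a.
Proof.
elim/tgwcW: a => a; elim/tgwcW: b => b.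
by rewrite -tgw_clsME !tgw_star_cls /= tgw_clsME.
Qed.

Lemma tgw_starZ (k : K) a : tgw_star (k *: a) = k *: tgw_star a.
Proof.
by rewrite tgw_scaleE tgw_starM tgw_starR -[tgwR _]mulr1 -tgw_scaleE
           -tgw_scaleAr mulr1.
Qed.

Lemma tgw_starK : involutive tgw_star.
Proof.
elim/tgwcW=> a; rewrite !tgw_star_cls; congr tgw_cls.
by elim: a => //= a -> b ->.
Qed.

End TGWC.

Arguments tgwc {K R n} D.
Arguments tgw_I {K R n} D.

(* Main.v *)
Require Import Defs.
From HB Require Import structures.
From mathcomp Require Import all_boot all_order all_algebra.
From mathcomp Require Import boolp classical_sets.

Set Implicit Arguments.
Unset Strict Implicit.
Unset Printing Implicit Defensive.

Import Order.TTheory GRing.Theory Num.Theory.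
Local Open Scope ring_scope.
Local Open Scope classical_set_scope.

(** Write x1, x2, y1, y2 for the generators, tau for sigma1 sigma2, and G for
    the ideal generated by s1, s2 and their stars.  That G lies in the maximal
    graded ideal I is formal: I is an ideal ([tgw_I_ideal]) and is stable under
    the star ([tgw_I_star]).  For the converse it is enough to treat a
    homogeneous a in a graded ideal that meets R trivially.

    The first ingredient is a faithful enough representation: A' acts on
    functions int -> R ([act]), R acts by multiplication, and every generator
    acts injectively because R is a domain.  Let a be homogeneous of degree d in
    such an ideal.  Multiplying a by a monomial of degree -d gives an element of
    A'_0 = R in the ideal, hence 0; as monomials act injectively, a acts as zero
    ([homog_act_ker]).  So all of I acts as zero, and it remains to show that a
    homogeneous a that acts as zero lies in G.

    Every element of degree d is a combination over R of monomials y_u x_v where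
    no index occurs in both words ([homog_reduced_span]).  If d has one
    coordinate of each sign, there is only one such monomial, and a = 0
    ([homog_mixed_act_ker]).  If d <= 0, the star of a has degree -d >= 0.  So
    let d = (p, q) with p, q >= 0; then a is a combination of words in x1, x2.
    Modulo s1 and s2 these words reduce to the normal monomials
    x1^(p-b) (x2 x1)^b x2^(q-b) with b <= min(p, q) ([X2_normal_mono],
    [wordX_normal_span]).

    The heart is a descent on the top index m of a combination
    sum_(b <= m) r_b x1^(p-b) (x2 x1)^b x2^(q-b) that acts as zero
    ([act_ker_normal_sum]).  The factor x1^(p-m) on the left can be cancelled,
    so take p = m.  Multiply on the left by y1^m: every monomial becomes an
    element of R times x2^q.  For b < m this element is divisible by
    sigma1^(1-m)(t1), since y1 x1 = t1 appears in the middle; for b = m it is,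
    up to a nonzero scalar, sigma1^(-m) of tau(t1) ... tau^m(t1) ([y1n_En]).
    As the sum acts as zero, sigma1(t1) divides r_m tau(t1) ... tau^m(t1), so by
    the divisibility hypothesis it divides r_m ([top_coef]).  But A' itself
    satisfies sigma1(t1) x2 x1 = mu^-1 tau(t1) x1 x2 ([sigma_t_X2X1]), which
    trades the top monomial for normal monomials with b < m
    ([top_normal_span]).  At m = 0 a single monomial is left, and its
    coefficient is 0. *)

(** * Ideals and the star *)

Section Ideals.

Context {K : fieldType} {R : comAlgType K} {n : nat} (D : tgw_datum R n).
Context (J : set (tgwc D)) (J_ideal : tgw_ideal J).

Lemma tgw_ideal0 : J 0. Proof. by case: J_ideal. Qed.

Lemma tgw_idealD a b : J a -> J b -> J (a + b).
Proof. by case: J_ideal => _ + _ _; apply. Qed.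

Lemma tgw_idealMl a b : J b -> J (a * b).
Proof. by case: J_ideal => _ _ + _; apply. Qed.

Lemma tgw_idealMr a b : J a -> J (a * b).
Proof. by case: J_ideal => _ _ _; apply. Qed.

Lemma tgw_idealB a b : J a -> J b -> J (a - b).
Proof. by move=> Ja Jb; rewrite -mulN1r; apply/tgw_idealD/tgw_idealMl. Qed.

End Ideals.

Section MaximalIdeal.

Context {K : fieldType} {R : comAlgType K} {n : nat} (D : tgw_datum R n).

Definition graded_off_R (J : set (tgwc D)) : Prop :=
  [/\ tgw_ideal J, tgw_graded J & J `&` range (tgwR D) = [set 0]].

(** This is what gradedness is for: an additive property needs checking only on
    the homogeneous elements of the ideals that make up I. *)
Lemma tgw_I_ind (P : tgwc D -> Prop) :
  P 0 -> (forall a b, P a -> P b -> P (a + b)) ->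
  (forall J a d, graded_off_R J -> J a -> tgw_homog d a -> P a) ->
  forall a, tgw_I D a -> P a.
Proof.
move=> P0 PD Phom a [s [sJ ->]]; rewrite big_seq; apply: big_ind => // b.
move=> /sJ[J [JI Jgr JR Jb]]; have [s' [s'J ->]] := Jgr b Jb.
rewrite big_seq; apply: big_ind => // p /s'J[hp Jp].
exact: (Phom J _ p.1).
Qed.

(** An additive map that preserves every ideal, such as a one-sided
    multiplication, preserves I because it can be applied to each summand. *)
Lemma tgw_I_ideal : tgw_ideal (tgw_I D).
Proof.
have mapI (f : tgwc D -> tgwc D) (s : seq (tgwc D)) :
    f 0 = 0 -> {morph f : a b / a + b} ->
    (forall J, tgw_ideal J -> forall a, J a -> J (f a)) ->
    (forall b, b \in s -> exists J : set (tgwc D),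
      [/\ tgw_ideal J, tgw_graded J, J `&` range (tgwR D) = [set 0] & J b]) ->
    tgw_I D (f (\sum_(b <- s) b)).
  move=> f0 fD fJ sJ; exists (map f s); split; last first.
    by rewrite (big_morph f fD f0) big_map.
  move=> _ /mapP[b /sJ[J [JI Jgr JR Jb]] ->].
  by exists J; split=> //; apply: fJ.
split=> [|a b [s [sJ ->]] [s' [s'J ->]]|a b [s [sJ ->]]|a b [s [sJ ->]]].
- by exists [::]; rewrite big_nil.
- exists (s ++ s'); split; last by rewrite big_cat.
  by move=> b'; rewrite mem_cat => /orP[/sJ|/s'J].
- apply: (mapI (fun b => a * b)) => // [|x y|J JI x]; first exact: mulr0.
    exact: mulrDr.
  exact: tgw_idealMl.
- apply: (mapI (fun a => a * b)) => // [|x y|J JI x]; first exact: mul0r.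
    exact: mulrDl.
  exact: tgw_idealMr.
Qed.

Lemma tgw_star0 : tgw_star (0 : tgwc D) = 0.
Proof. by rewrite -(rmorph0 (tgwR D)) tgw_starR. Qed.

Lemma tgw_star_homog d (a : tgwc D) :
  tgw_homog d a -> tgw_homog (- d) (tgw_star a).
Proof.
elim=> {d a} [r|i|i|d|d a b _ IHa _ IHb|d e a b _ IHa _ IHb].
- by rewrite oppr0 tgw_starR; apply: homog_R.
- by rewrite tgw_starX; apply: homog_Y.
- by rewrite opprK tgw_starY; apply: homog_X.
- by rewrite tgw_star0; apply: homog_zero.
- by rewrite tgw_starD; apply: homog_add.
- by rewrite tgw_starM opprD addrC; apply: homog_mul.
Qed.

Lemma star_ideal (J : set (tgwc D)) :
  tgw_ideal J -> tgw_ideal [set a | J (tgw_star a)].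
Proof.
move=> JI; split=> [|a b|a b|a b] /=.
- by rewrite tgw_star0; apply: tgw_ideal0.
- by rewrite tgw_starD; apply: tgw_idealD.
- by rewrite tgw_starM; apply: tgw_idealMr.
- by rewrite tgw_starM; apply: tgw_idealMl.
Qed.

Lemma star_graded_off_R J :
  graded_off_R J -> graded_off_R [set a | J (tgw_star a)].
Proof.
move=> [JI Jgr JR]; split; first exact: star_ideal.
  move=> a /Jgr[s [sJ e]]; exists [seq (- p.1, tgw_star p.2) | p <- s]; split.
    move=> _ /mapP[p /sJ[hp Jp] ->] /=; split; first exact: tgw_star_homog.
    by rewrite tgw_starK.
  rewrite big_map -[a]tgw_starK e.
  exact: (big_morph _ (@tgw_starD _ _ _ D) tgw_star0).
apply/seteqP; split=> [a [/= Ja [r _ ra]]|_ ->].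
  have : (J `&` range (tgwR D)) a.
    by split; [move: Ja; rewrite -ra tgw_starR|exists r].
  by rewrite JR.
split; first by rewrite /= tgw_star0; apply: tgw_ideal0.
by exists 0; rewrite ?rmorph0.
Qed.

Lemma tgw_I_star a : tgw_I D a -> tgw_I D (tgw_star a).
Proof.
move=> [s [sJ ->]]; exists (map (@tgw_star _ _ _ D) s); split; last first.
  by rewrite big_map (big_morph _ (@tgw_starD _ _ _ D) tgw_star0).
move=> _ /mapP[b /sJ[J [JI Jgr JR Jb]] ->].
have [JI' Jgr' JR'] := star_graded_off_R (And3 JI Jgr JR).
by exists [set a | J (tgw_star a)]; split; rewrite //= tgw_starK.
Qed.

Lemma ideal_gen_ideal (S : set (tgwc D)) : tgw_ideal (tgw_ideal_gen S).
Proof.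
split=> [|a b Sa Sb|a b Sb|a b Sa] J [JI SJ]; first exact: tgw_ideal0.
- by apply: tgw_idealD (Sa J _) (Sb J _).
- by apply: tgw_idealMl => //; apply: Sb.
- by apply: tgw_idealMr => //; apply: Sa.
Qed.

Lemma sub_ideal_gen (S : set (tgwc D)) : S `<=` tgw_ideal_gen S.
Proof. exact: sub_smallest. Qed.

End MaximalIdeal.

(** * A representation of A' on functions from int to R *)

Lemma ord2P (i : 'I_2) : i = ord0 \/ i = ord_max.
Proof. by case: i => [[|[|//]] ?]; [left|right]; apply: val_inj. Qed.

Section Representation.

Context {K : fieldType} {R : comAlgType K} (D : tgw_datum R 2).

Local Notation sigma := (tgw_sigma D).
Local Notation sigmaV := (tgw_sigmaV D).
Local Notation t := (tgw_t D).
Local Notation mu := (tgw_mu D ord0 ord_max).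

Lemma sigma_sigmaVC i j r : sigma i (sigmaV j r) = sigmaV j (sigma i r).
Proof.
by apply: (can_inj (tgw_sigmaK D j)); rewrite tgw_sigmaC !tgw_sigmaVK.
Qed.

(** The integer variable k records the degree in the first generator.  With no
    weights, x1 and y2 would commute; the factor mu^k makes them commute up to
    mu, and then the compatibility of t with mu gives the relation of x2 with
    y1.  No weight depends on the degree in the second generator, so x2 and y2
    do not shift anything. *)
Definition act_X (i : 'I_2) (f : int -> R) (k : int) : R :=
  if i == ord0 then sigma ord0 (f (k - 1))
  else mu ^ k *: sigma ord_max (t ord_max * f k).

Definition act_Y (i : 'I_2) (f : int -> R) (k : int) : R :=
  if i == ord0 then t ord0 * sigmaV ord0 (f (k + 1))
  else mu ^ (- k) *: sigmaV ord_max (f k).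

Fixpoint term_act (a : @tgw_term K R 2) (f : int -> R) : int -> R :=
  match a with
  | TCoef r => fun k => r * f k
  | TX i => act_X i f
  | TY i => act_Y i f
  | TAdd a b => fun k => term_act a f k + term_act b f k
  | TMul a b => term_act a (term_act b f)
  end.

Lemma term_act_linear a (c : K) f g k :
  term_act a (fun j => c *: f j + g j) k
    = c *: term_act a f k + term_act a g k.
Proof.
elim: a f g k => [r|i|i|a IHa b IHb|a IHa b IHb] f g k /=.
- by rewrite mulrDr scalerAr.
- rewrite /act_X; case: ifP => _; first by rewrite linearP.
  by rewrite mulrDr -scalerAr linearP /= scalerDr !scalerA mulrC.
- rewrite /act_Y; case: ifP => _.
    by rewrite linearP mulrDr -scalerAr.
  by rewrite linearP /= scalerDr !scalerA mulrC.
- by rewrite IHa IHb scalerDr addrACA.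
- rewrite -IHa; congr term_act; apply/funext=> j; exact: IHb.
Qed.

Lemma term_actD a f g k :
  term_act a (fun j => f j + g j) k = term_act a f k + term_act a g k.
Proof.
rewrite -[term_act a f k]scale1r -term_act_linear.
by congr (term_act _ _ _); apply/funext=> j; rewrite scale1r.
Qed.

Lemma term_act0 a k : term_act a (fun=> 0) k = 0.
Proof.
by apply/(addrI (term_act a (fun=> 0) k)); rewrite -term_actD !addr0.
Qed.

Lemma term_actZ a (c : K) f k :
  term_act a (fun j => c *: f j) k = c *: term_act a f k.
Proof.
rewrite -[RHS]addr0 -(term_act0 a k) -term_act_linear.
by congr (term_act _ _ _); apply/funext=> j; rewrite addr0.
Qed.

Lemma mu_neq0 : mu != 0. Proof. exact: tgw_mu_neq0. Qed.

(** The consistency condition in the form in which it says that x2 and y1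
    commute up to mu in the representation. *)
Lemma consistent_sigma2 : sigma ord_max (t ord_max * t ord0)
  = (mu * mu) *: (t ord0 * sigmaV ord0 (sigma ord_max (t ord_max))).
Proof.
rewrite [t ord_max * _]mulrC tgw_consistent // linearZ rmorphM /= tgw_sigmaVK.
by rewrite sigma_sigmaVC (tgw_mu_sym D (i := ord_max)).
Qed.

Lemma term_act_eqv a b : tgw_eqv D a b -> term_act a = term_act b.
Proof.
have muZ (k : int) : mu ^ k * mu ^ (- k) = 1.
  by rewrite -expfzDr ?mu_neq0 // subrr.
have muZ' (k : int) : mu ^ (- k) * mu ^ k = 1 by rewrite mulrC muZ.
elim=> {a b} //=.
- by move=> a b c _ -> _ ->.
- by move=> a a' b b' _ -> _ ->.
- by move=> a a' b b' _ -> _ ->.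
- by move=> a b c; apply/funext=> f; apply/funext=> k; rewrite addrA.
- by move=> a b; apply/funext=> f; apply/funext=> k; rewrite addrC.
- by move=> a; apply/funext=> f; apply/funext=> k; rewrite mul0r add0r.
- by move=> a; apply/funext=> f; apply/funext=> k; rewrite mulN1r addNr mul0r.
- by move=> a; apply/funext=> f; apply/funext=> k; rewrite mul1r.
- move=> a; apply/funext=> f; apply/funext=> k; congr (term_act a _ _).
  by apply/funext=> j; rewrite mul1r.
- by move=> a b c; apply/funext=> f; apply/funext=> k; rewrite term_actD.
- move=> c a; apply/funext=> f; apply/funext=> k.
  rewrite mulr_algl -term_actZ; congr (term_act a _ _).
  by apply/funext=> j; rewrite mulr_algl.
- by move=> r s; apply/funext=> f; apply/funext=> k; rewrite mulrDl.
- by move=> r s; apply/funext=> f; apply/funext=> k; rewrite mulrA.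
- move=> i r; apply/funext=> f; apply/funext=> k; rewrite /act_X.
  case: (ord2P i) => -> /=; first by rewrite rmorphM.
  by rewrite mulrCA rmorphM /= scalerAr.
- move=> i r; apply/funext=> f; apply/funext=> k; rewrite /act_Y.
  case: (ord2P i) => -> /=; first by rewrite rmorphM /= mulrCA.
  by rewrite rmorphM /= scalerAr.
- move=> i; apply/funext=> f; apply/funext=> k; rewrite /act_X /act_Y.
  case: (ord2P i) => -> /=; first by rewrite addrK tgw_sigmaK.
  by rewrite linearZ /= scalerA muZ' scale1r tgw_sigmaK.
- move=> i; apply/funext=> f; apply/funext=> k; rewrite /act_X /act_Y.
  case: (ord2P i) => -> /=; first by rewrite subrK rmorphM /= tgw_sigmaVK.
  rewrite -scalerAr linearZ /= scalerA muZ scale1r.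
  by rewrite rmorphM /= tgw_sigmaVK.
move=> i j ij; apply/funext=> f; apply/funext=> k.
rewrite /act_X /act_Y mulr_algl.
move: ij; case: (ord2P i) => ->; case: (ord2P j) => -> //= _.
  rewrite linearZ /= scalerA sigma_sigmaVC; congr (_ *: _).
  by rewrite opprB addrC expfzDr ?mu_neq0 // mulrC.
rewrite (tgw_mu_sym D (i := ord_max)) // mulrA rmorphM /=.
rewrite consistent_sigma2 linearZ /= rmorphM /= sigma_sigmaVC.
rewrite -scalerAl -scalerAr !scalerA mulrA expfzDr ?mu_neq0 //.
by congr (_ *: _); rewrite ?expr1z ?[mu * (_ * _)]mulrC ?rmorphM ?mulrA.
Qed.

Definition act (x : tgwc D) : (int -> R) -> int -> R := term_act (tgw_repr x).

Lemma act_cls a : act (tgw_cls D a) = term_act a.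
Proof. exact/term_act_eqv/tgw_repr_cls. Qed.

Lemma actR r f k : act (tgwR D r) f k = r * f k.
Proof. by rewrite act_cls. Qed.

Lemma actM x y f : act (x * y) f = act x (act y f).
Proof.
rewrite -[x](@tgw_reprK _ _ _ D) -[y](@tgw_reprK _ _ _ D).
by rewrite -tgw_clsME !act_cls.
Qed.

Lemma actD x y f k : act (x + y) f k = act x f k + act y f k.
Proof.
rewrite -[x](@tgw_reprK _ _ _ D) -[y](@tgw_reprK _ _ _ D).
by rewrite -tgw_clsDE !act_cls.
Qed.

Lemma act_0 x : act x (fun=> 0) = fun=> 0.
Proof. by apply/funext=> k; apply: term_act0. Qed.

Definition act_ker (x : tgwc D) : Prop := forall f k, act x f k = 0.

Lemma act_ker_ideal : tgw_ideal act_ker.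
Proof.
have act0 f k : act 0 f k = 0 by rewrite -(rmorph0 (tgwR D)) actR mul0r.
split=> // [a b ka kb f k|a b kb f k|a b ka f k].
- by rewrite actD ka kb addr0.
- by rewrite actM (_ : act b f = fun=> 0) ?act_0 //; apply/funext=> j.
- by rewrite actM.
Qed.

Context (R_domain : GRing.integral_domain_axiom R).

Definition act_injective (x : tgwc D) : Prop :=
  forall f, (forall k, act x f k = 0) -> forall k, f k = 0.

(** Applied to y_i x_i = t_i and x_i y_i = sigma_i(t_i), this gives the
    injectivity of every generator without looking at the formulas of the
    action. *)
Lemma act_injective_factor x y r :
  r != 0 -> y * x = tgwR D r -> act_injective x.
Proof.
move=> r0 yx f xf0 k; have /R_domain : r * f k = 0.
  by rewrite -actR -yx actM (_ : act x f = fun=> 0) ?act_0 //; apply/funext.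
by rewrite (negPf r0) => /eqP.
Qed.

Lemma act_injectiveX i : act_injective (tgwX D i).
Proof. exact: (act_injective_factor (tgw_t_neq0 D i) (tgwYX D i)). Qed.

Lemma act_injectiveY i : act_injective (tgwY D i).
Proof.
apply: (act_injective_factor _ (tgwXY D i)).
apply: contraNneq (tgw_t_neq0 D i) => t0.
by rewrite -(tgw_sigmaK D i (t i)) t0 rmorph0.
Qed.

Lemma act_injectiveM x y :
  act_injective x -> act_injective y -> act_injective (x * y).
Proof. by move=> ix iy f; rewrite actM => xy0; apply/iy/ix. Qed.

Lemma act_injective1 : act_injective 1.
Proof.
by move=> f f0 k; have := f0 k; rewrite -(rmorph1 (tgwR D)) actR mul1r.
Qed.

Lemma act_injectiveXn x n : act_injective x -> act_injective (x ^+ n).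
Proof.
move=> ix; elim: n => [|n IHn]; first exact: act_injective1.
by rewrite exprS; apply: act_injectiveM.
Qed.

Lemma act_ker_cancel x y : act_injective x -> act_ker (x * y) -> act_ker y.
Proof. by move=> ix xy f k; apply: (ix) => j; rewrite -actM. Qed.

(** In particular (x = 1) R embeds into A'. *)
Lemma tgwR_mul_act_ker r x : act_injective x -> act_ker (tgwR D r * x) -> r = 0.
Proof.
move=> ix rx; apply/eqP/negP => /negP r0.
suff one0 (k : int) : 1 = 0 :> R by have /eqP := one0 0; rewrite oner_eq0.
apply: (ix (fun=> 1) _ k) => {}k; have := rx (fun=> 1) k; rewrite actM actR.
by move/R_domain; rewrite (negPf r0) => /eqP.
Qed.

End Representation.

(** * Monomials and homogeneous elements *)

Section Words.

Context {K : fieldType} {R : comAlgType K} (D : tgw_datum R 2).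

Local Notation sigma := (tgw_sigma D).
Local Notation sigmaV := (tgw_sigmaV D).
Local Notation t := (tgw_t D).
Local Notation X := (tgwX D).
Local Notation Y := (tgwY D).

Definition wordX (v : seq 'I_2) : tgwc D := \prod_(i <- v) X i.
Definition wordY (u : seq 'I_2) : tgwc D := \prod_(i <- u) Y i.

Definition word_degree (v : seq 'I_2) : 'rV[int]_2 :=
  \sum_(i <- v) delta_mx 0 i.

(** No index occurs in both words, so that no y_i x_i in wordY u * wordX v can
    be brought together and replaced by t_i. *)
Definition reduced (u v : seq 'I_2) : bool := all [predC v] u.

Inductive reduced_span (d : 'rV[int]_2) : tgwc D -> Prop :=
| reduced_span0 : reduced_span d 0
| reduced_spanD a b :
    reduced_span d a -> reduced_span d b -> reduced_span d (a + b)
| reduced_span_word r u v : reduced u v -> word_degree v - word_degree u = d ->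
    reduced_span d (tgwR D r * (wordY u * wordX v)).

Lemma wordX_cons i v : wordX (i :: v) = X i * wordX v.
Proof. exact: big_cons. Qed.
Lemma wordY_cons i u : wordY (i :: u) = Y i * wordY u.
Proof. exact: big_cons. Qed.
Lemma wordX_nil : wordX [::] = 1. Proof. exact: big_nil. Qed.
Lemma wordY_nil : wordY [::] = 1. Proof. exact: big_nil. Qed.
Lemma word_degree_cons i v :
  word_degree (i :: v) = delta_mx 0 i + word_degree v.
Proof. exact: big_cons. Qed.

Lemma word_degreeE v j : word_degree v 0 j = (count_mem j v)%:Z.
Proof.
elim: v => [|i v IHv]; first by rewrite /word_degree big_nil mxE.
rewrite word_degree_cons mxE IHv mxE eqxx /= PoszD eq_sym.
by case: eqP.
Qed.

(** In a reduced monomial the sign of the degree in x_j decides which of x_j and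
    y_j can occur. *)
Lemma reduced_degree_ge0 u v j :
  reduced u v -> 0 <= (word_degree v - word_degree u) 0 j -> j \notin u.
Proof.
move=> uv; apply: contraL => ju; have /= jv := allP uv j ju.
rewrite !mxE !word_degreeE (count_memPn jv) sub0r oppr_ge0 -ltNge.
by rewrite ltz_nat -has_count has_pred1.
Qed.

Lemma reduced_degree_le0 u v j :
  reduced u v -> (word_degree v - word_degree u) 0 j <= 0 -> j \notin v.
Proof.
move=> uv; apply: contraL => jv.
have ju : j \notin u by apply: contraL jv => /(allP uv).
rewrite !mxE !word_degreeE (count_memPn ju) subr0 -ltNge.
by rewrite ltz_nat -has_count has_pred1.
Qed.

Lemma notin_nil (u : seq 'I_2) : (forall j, j \notin u) -> u = [::].
Proof. by case: u => // i u /(_ i); rewrite mem_head. Qed.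

Lemma tgwYXmu i j : i != j -> Y i * X j = (tgw_mu D j i)^-1 *: (X j * Y i).
Proof.
move=> ij; rewrite tgwXYmu 1?eq_sym // scalerA mulVf ?scale1r //.
by rewrite tgw_mu_neq0 // eq_sym.
Qed.

Lemma X_wordY_notin i u : i \notin u ->
  exists2 k : K, k != 0 & X i * wordY u = k *: (wordY u * X i).
Proof.
elim: u => [_|j u IHu].
  by exists 1; rewrite ?oner_neq0 // wordY_nil mul1r mulr1 scale1r.
rewrite inE negb_or => /andP[ij /IHu[k k0 e]].
exists (tgw_mu D i j * k); first by rewrite mulf_neq0 ?tgw_mu_neq0.
rewrite wordY_cons mulrA tgwXYmu // -tgw_scaleAl -mulrA e -tgw_scaleAr scalerA.
by rewrite mulrA.
Qed.

(** x_i moves right, commuting with the other y_j up to scalars, and is absorbed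
    by the first y_i that it meets. *)
Lemma X_wordY_in i u : i \in u ->
  exists c u', perm_eq u (i :: u') /\ X i * wordY u = tgwR D c * wordY u'.
Proof.
elim: u => // j u IHu; rewrite inE wordY_cons mulrA.
have [-> _|ij /IHu[c [u' [uu' e]]]] := eqVneq i j.
  by exists (sigma j (t j)), u; rewrite tgwXY.
exists (tgw_mu D i j *: sigmaV j c), (j :: u'); split.
  rewrite -(perm_cons j) in uu'; rewrite (perm_trans uu') // -cat1s.
  by rewrite (perm_catCA [:: j] [:: i]).
rewrite tgwXYmu // -tgw_scaleAl -mulrA e mulrA tgwYr wordY_cons tgwRZ.
by rewrite -tgw_scaleAl mulrA.
Qed.

Lemma Y_wordX_in i v : i \in v ->
  exists c v', perm_eq v (i :: v') /\ Y i * wordX v = tgwR D c * wordX v'.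
Proof.
elim: v => // j v IHv; rewrite inE wordX_cons mulrA.
have [-> _|ij /IHv[c [v' [vv' e]]]] := eqVneq i j.
  by exists (t j), v; rewrite tgwYX.
exists ((tgw_mu D j i)^-1 *: sigma j c), (j :: v'); split.
  rewrite -(perm_cons j) in vv'; rewrite (perm_trans vv') // -cat1s.
  by rewrite (perm_catCA [:: j] [:: i]).
rewrite tgwYXmu // -tgw_scaleAl -mulrA e mulrA tgwXr wordX_cons tgwRZ.
by rewrite -tgw_scaleAl mulrA.
Qed.

Lemma perm_word_degree u v : perm_eq u v -> word_degree u = word_degree v.
Proof. exact: perm_big. Qed.

Lemma reduced_spanR d r a : reduced_span d a -> reduced_span d (tgwR D r * a).
Proof.
elim=> [|x y _ IHx _ IHy|s u v uv duv].
- by rewrite mulr0; apply: reduced_span0.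
- by rewrite mulrDr; apply: reduced_spanD.
by rewrite mulrA -rmorphM; apply: reduced_span_word.
Qed.

Lemma reduced_span_mull (g : tgwc D) (s : R -> R) e d a :
  (forall r, g * tgwR D r = tgwR D (s r) * g) ->
  (forall u v, reduced u v ->
    reduced_span (e + (word_degree v - word_degree u))
      (g * (wordY u * wordX v))) ->
  reduced_span d a -> reduced_span (e + d) (g * a).
Proof.
move=> gs gw; elim=> [|x y _ IHx _ IHy|r u v uv <-].
- by rewrite mulr0; apply: reduced_span0.
- by rewrite mulrDr; apply: reduced_spanD.
- by rewrite mulrA gs -mulrA; apply/reduced_spanR/gw.
Qed.

Lemma reduced_spanX i d a :
  reduced_span d a -> reduced_span (delta_mx 0 i + d) (X i * a).
Proof.
apply: (reduced_span_mull (tgwXr D i)) => u v uv.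
have [iu|iu] := boolP (i \in u); rewrite mulrA.
  have [c [u' [uu' ->]]] := X_wordY_in iu; rewrite -mulrA.
  apply: reduced_span_word.
    by move: uv; rewrite /reduced (perm_all _ uu') => /andP[].
  rewrite (perm_word_degree uu') word_degree_cons opprD [RHS]addrCA.
  by rewrite addNKr.
have [k _ ->] := X_wordY_notin iu; rewrite tgw_scaleE -!mulrA -wordX_cons.
apply: reduced_span_word; last by rewrite word_degree_cons addrA.
apply/allP => j ju; have /= jv := allP uv j ju; rewrite /= inE negb_or jv andbT.
by apply: contraNneq iu => <-.
Qed.

(** This is where rank 2 matters.  If y_i has to reach an x_i across a nonempty
    word in the y_j, then j is the index different from i, the word in the x is
    a power of x_i, and x_i can be moved left next to y_i. *)
Lemma reduced_spanY i d a :
  reduced_span d a -> reduced_span (- delta_mx 0 i + d) (Y i * a).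
Proof.
apply: (reduced_span_mull (tgwYr D i)) => u v uv.
have [iv|iv] := boolP (i \in v); last first.
  rewrite mulrA -wordY_cons -[_ * _]mul1r -(rmorph1 (tgwR D)).
  apply: reduced_span_word; first by rewrite /reduced /= iv.
  by rewrite word_degree_cons opprD addrCA.
have iu : i \notin u by apply: contraL iv => /(allP uv).
have [k k0 e] := X_wordY_notin iu.
case: u => [|j u] in uv iu e *.
  have [c [v' [vv' e']]] := Y_wordX_in iv.
  rewrite wordY_nil mul1r e' -[wordX v']mul1r -wordY_nil.
  apply: reduced_span_word => //.
  by rewrite (perm_word_degree vv') word_degree_cons addrA addKr.
have jv : j \notin v by case/andP: uv.
case: v => // b v in uv iv jv *; have bi : b = i.
  move: iu jv; rewrite !inE !negb_or => /andP[ij _] /andP[jb _].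
  move: ij jb; case: (ord2P i) => ->; case: (ord2P j) => ->;
  by case: (ord2P b) => ->.
rewrite {}bi in uv iv jv *.
have e' : wordY (j :: u) * X i = k^-1 *: (X i * wordY (j :: u)).
  by rewrite e scalerA mulVf ?scale1r.
rewrite wordX_cons (mulrA _ (X i)) e' -tgw_scaleAl -tgw_scaleAr 2!mulrA tgwYX.
rewrite tgw_scaleE -mulrA mulrA -rmorphM; apply: reduced_span_word.
  by apply: sub_all uv => c; rewrite /= inE negb_or => /andP[].
by rewrite (word_degree_cons i v) -addrA addKr.
Qed.

Lemma reduced_spanM d e a b : reduced_span d a -> reduced_span e b ->
  reduced_span (d + e) (a * b).
Proof.
move=> da eb; elim: da => [|x y _ IHx _ IHy|r u v _ <-].
- by rewrite mul0r; apply: reduced_span0.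
- by rewrite mulrDl; apply: reduced_spanD.
rewrite -mulrA; apply: reduced_spanR; rewrite -mulrA.
rewrite [_ - _]addrC -addrA.
elim: u => [|i u IHu].
  rewrite wordY_nil mul1r /word_degree big_nil oppr0 add0r -/(word_degree v).
  elim: v => [|i v IHv].
    by rewrite wordX_nil mul1r /word_degree big_nil add0r.
  by rewrite word_degree_cons wordX_cons -addrA -mulrA; apply: reduced_spanX.
rewrite word_degree_cons wordY_cons opprD -addrA -mulrA.
exact: reduced_spanY.
Qed.

Lemma reduced_span1 : reduced_span 0 1.
Proof.
have := @reduced_span_word 0 1 [::] [::] isT.
by rewrite wordX_nil wordY_nil rmorph1 !mulr1; apply; rewrite subrr.
Qed.

Lemma homog_reduced_span d a : tgw_homog d a -> reduced_span d a.
Proof.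
elim=> {d a} [r|i|i|d|d a b _ IHa _ IHb|d e a b _ IHa _ IHb].
- by rewrite -[tgwR D r]mulr1; apply/reduced_spanR/reduced_span1.
- rewrite -[X i]mulr1 -[delta_mx 0 i]addr0.
  exact/reduced_spanX/reduced_span1.
- rewrite -[Y i]mulr1 -[- delta_mx 0 i]addr0.
  exact/reduced_spanY/reduced_span1.
- exact: reduced_span0.
- exact: reduced_spanD.
- exact: reduced_spanM.
Qed.

Lemma homog_degree0 a : tgw_homog 0 a -> exists r, a = tgwR D r.
Proof.
move/homog_reduced_span; elim=> [|x y _ [r ->] _ [s ->]|r u v uv d0].
- by exists 0; rewrite rmorph0.
- by exists (r + s); rewrite rmorphD.
exists r; rewrite (notin_nil (u := u)) => [|j]; last first.
  by apply: reduced_degree_ge0 uv _; rewrite d0 mxE.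
rewrite (notin_nil (u := v)) => [|j]; last first.
  by apply: reduced_degree_le0 uv _; rewrite d0 mxE.
by rewrite wordX_nil wordY_nil !mulr1.
Qed.

Lemma wordX_homog v : tgw_homog (word_degree v) (wordX v).
Proof.
elim: v => [|i v IHv].
  by rewrite wordX_nil /word_degree big_nil -(rmorph1 (tgwR D)); apply: homog_R.
by rewrite wordX_cons word_degree_cons; apply: homog_mul => //; apply: homog_X.
Qed.

Lemma wordY_homog u : tgw_homog (- word_degree u) (wordY u).
Proof.
elim: u => [|i u IHu].
  rewrite wordY_nil /word_degree big_nil oppr0 -(rmorph1 (tgwR D)).
  exact: homog_R.
rewrite wordY_cons word_degree_cons opprD.
by apply: homog_mul => //; apply: homog_Y.
Qed.

Context (R_domain : GRing.integral_domain_axiom R).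

Lemma act_injective_wordX v : act_injective (wordX v).
Proof.
elim: v => [|i v IHv]; first by rewrite wordX_nil; apply: act_injective1.
by rewrite wordX_cons; apply/act_injectiveM/IHv/act_injectiveX.
Qed.

Lemma act_injective_wordY u : act_injective (wordY u).
Proof.
elim: u => [|i u IHu]; first by rewrite wordY_nil; apply: act_injective1.
by rewrite wordY_cons; apply/act_injectiveM/IHu/act_injectiveY.
Qed.

Lemma reduced_span_word_or0 d a : reduced_span d a ->
  a = 0 \/ exists u v, word_degree v - word_degree u = d.
Proof.
elim=> [|x y _ + _ + |r u v _ e]; [by left| |by right; exists u, v].
by move=> [->|?] [->|?]; try (by right); left; rewrite addr0.
Qed.

(** A monomial q of degree -d acts injectively, and q a has degree 0, so it lies
    in J and in R; hence q a = 0 and a acts as zero. *)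
Lemma homog_act_ker (J : set (tgwc D)) d a :
  tgw_ideal J -> J `&` range (tgwR D) = [set 0] ->
  tgw_homog d a -> J a -> act_ker a.
Proof.
move=> JI JR ha Ja.
have [->|[u [v duv]]] := reduced_span_word_or0 (homog_reduced_span ha).
  exact: tgw_ideal0 (act_ker_ideal D).
apply: (@act_ker_cancel _ _ _ (wordY v * wordX u)).
  by apply/act_injectiveM/act_injective_wordX/act_injective_wordY.
have [r e] : exists r, wordY v * wordX u * a = tgwR D r.
  apply: homog_degree0; rewrite -(addNr d); apply: homog_mul ha.
  rewrite -duv opprB addrC.
  by apply: homog_mul; [exact: wordY_homog|exact: wordX_homog].
suff -> : wordY v * wordX u * a = 0 by exact: tgw_ideal0 (act_ker_ideal D).
have : (J `&` range (tgwR D)) (wordY v * wordX u * a).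
  by split; [exact: tgw_idealMl|rewrite e; exists r].
by rewrite JR.
Qed.

End Words.

(** * Normal monomials span modulo s1 and s2 *)

Section NormalForms.

Context {K : fieldType} {R : comAlgType K} (D : tgw_datum R 2).

Local Notation sigma1 := (tgw_sigma D ord0).
Local Notation sigma2 := (tgw_sigma D ord_max).
Local Notation sigmaV1 := (tgw_sigmaV D ord0).
Local Notation t1 := (tgw_t D ord0).
Local Notation r_ := (tgwR D).
Local Notation x1 := (tgwX D ord0).
Local Notation x2 := (tgwX D ord_max).
Local Notation y1 := (tgwY D ord0).

Definition normal_mono (a c b : nat) : tgwc D :=
  x1 ^+ (a - b) * (x2 * x1) ^+ b * x2 ^+ (c - b).

Lemma normal_monoX1 a c b : (b <= a)%N ->
  x1 * normal_mono a c b = normal_mono a.+1 c b.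
Proof. by move=> ba; rewrite /normal_mono subSn // exprS !mulrA. Qed.

Lemma normal_monoX2 a c b : (b <= c)%N ->
  normal_mono a c b * x2 = normal_mono a c.+1 b.
Proof. by move=> bc; rewrite /normal_mono subSn // exprSr !mulrA. Qed.

Section Spanning.

Context (J : set (tgwc D)) (J_ideal : tgw_ideal J).

(** Only the indices b <= m are allowed; the bound m is what the descent
    decreases. *)
Definition normal_span (a c m : nat) (z : tgwc D) : Prop :=
  exists r : nat -> R, J (z - \sum_(b < m.+1) r_ (r b) * normal_mono a c b).

Lemma normal_span_mod a c m z z' :
  J (z - z') -> normal_span a c m z' -> normal_span a c m z.
Proof.
move=> Jz [r Jr]; exists r; rewrite -(subrKA z').
exact: (tgw_idealD J_ideal).
Qed.

Lemma normal_span_ideal a c m z : J z -> normal_span a c m z.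
Proof.
move=> Jz; exists (fun=> 0); rewrite big1 ?subr0 // => b _.
by rewrite rmorph0 mul0r.
Qed.

Lemma normal_spanD a c m z z' :
  normal_span a c m z -> normal_span a c m z' -> normal_span a c m (z + z').
Proof.
move=> [r Jr] [r' Jr']; exists (fun b => r b + r' b).
under eq_bigr do rewrite rmorphD mulrDl.
by rewrite big_split opprD addrACA; exact: (tgw_idealD J_ideal).
Qed.

Lemma normal_spanR a c m s z :
  normal_span a c m z -> normal_span a c m (r_ s * z).
Proof.
move=> [r Jr]; exists (fun b => s * r b).
under eq_bigr do rewrite rmorphM -mulrA.
by rewrite -mulr_sumr -mulrBr; exact: (tgw_idealMl J_ideal).
Qed.

Lemma normal_spanZ a c m (k : K) z :
  normal_span a c m z -> normal_span a c m (k *: z).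
Proof. by rewrite tgw_scaleE; apply: normal_spanR. Qed.

Lemma normal_span_sum a c m n (F : 'I_n -> tgwc D) :
  (forall b, normal_span a c m (F b)) -> normal_span a c m (\sum_(b < n) F b).
Proof.
move=> spanF; apply: big_ind => // [|z z']; last exact: normal_spanD.
exact/normal_span_ideal/(tgw_ideal0 J_ideal).
Qed.

Lemma normal_span_mono a c m b :
  (b <= m)%N -> normal_span a c m (normal_mono a c b).
Proof.
move=> bm; exists (fun j => (j == b)%:R).
rewrite (bigD1 (inord b)) //= inordK ?ltnS // eqxx rmorph1 mul1r big1 ?addr0.
  by rewrite subrr; apply: tgw_ideal0.
move=> j; rewrite -val_eqE /= inordK ?ltnS // => /negPf ->.
by rewrite rmorph0 mul0r.
Qed.

Lemma normal_span_mull (g : tgwc D) (s : R -> R) a c m a' c' m' z :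
  (forall r, g * r_ r = r_ (s r) * g) ->
  (forall b, (b <= m)%N -> normal_span a' c' m' (g * normal_mono a c b)) ->
  normal_span a c m z -> normal_span a' c' m' (g * z).
Proof.
move=> gs gspan [r Jr].
pose w := \sum_(b < m.+1) r_ (r b) * normal_mono a c b.
apply: (normal_span_mod (z' := g * w)).
  by rewrite -mulrBr; exact: (tgw_idealMl J_ideal).
rewrite /w mulr_sumr; apply: normal_span_sum => b /=.
by rewrite mulrA gs -mulrA; apply/normal_spanR/gspan; rewrite -ltnS.
Qed.

Lemma normal_span_widen a c m m' z : (m <= m')%N ->
  normal_span a c m z -> normal_span a c m' z.
Proof.
move=> mm' zm; rewrite -[z]mul1r; apply: (normal_span_mull (s := id)) zm.
  by move=> r; rewrite mul1r mulr1.
by move=> b bm; rewrite mul1r; apply/normal_span_mono/(leq_trans bm).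
Qed.

Lemma normal_spanX1 a c m z : (m <= a)%N ->
  normal_span a c m z -> normal_span a.+1 c m (x1 * z).
Proof.
move=> ma; apply: (normal_span_mull (tgwXr D ord0)) => b bm.
by rewrite normal_monoX1 ?(leq_trans bm) //; apply: normal_span_mono.
Qed.

Lemma normal_spanX1n j a c m z : (m <= a)%N ->
  normal_span a c m z -> normal_span (j + a) c m (x1 ^+ j * z).
Proof.
move=> ma zm; elim: j => [|j IHj]; first by rewrite mul1r.
rewrite exprS -mulrA addSn; apply: normal_spanX1 => //.
by rewrite (leq_trans ma) ?leq_addl.
Qed.

Lemma normal_spanX2r a c m z : (m <= c)%N ->
  normal_span a c m z -> normal_span a c.+1 m (z * x2).
Proof.
move=> mc [r Jr]; exists r.
rewrite (eq_bigr (fun b : 'I_m.+1 => r_ (r b) * normal_mono a c b * x2)).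
  by rewrite -mulr_suml -mulrBl; exact: tgw_idealMr.
move=> b _; rewrite -mulrA normal_monoX2 //.
by rewrite (leq_trans _ mc) // -ltnS.
Qed.

Lemma normal_spanX2nr j a c m z : (m <= c)%N ->
  normal_span a c m z -> normal_span a (j + c) m (z * x2 ^+ j).
Proof.
move=> mc zm; elim: j => [|j IHj]; first by rewrite mulr1.
rewrite exprSr mulrA addSn; apply: normal_spanX2r => //.
by rewrite (leq_trans mc) ?leq_addl.
Qed.

Context (xi1 xi2 eta1 eta2 : K).
Context (s1J :
  J (x2 * x1 ^+ 2 - xi1 *: (x1 * x2 * x1) - xi2 *: (x1 ^+ 2 * x2))).
Context (s2J :
  J (x2 ^+ 2 * x1 - eta1 *: (x2 * x1 * x2) - eta2 *: (x1 * x2 ^+ 2))).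

Lemma serre1 a c m w :
  normal_span a c m
    (xi1 *: (x1 * (x2 * (x1 * w))) + xi2 *: (x1 * (x1 * (x2 * w)))) ->
  normal_span a c m (x2 * (x1 * (x1 * w))).
Proof.
apply: normal_span_mod; move: (tgw_idealMr J_ideal w s1J).
by rewrite !mulrBl -!tgw_scaleAl !expr2 !mulrA opprD addrA.
Qed.

Lemma serre2 a c m w :
  normal_span a c m
    (eta1 *: (x2 * (x1 * (x2 * w))) + eta2 *: (x1 * (x2 * (x2 * w)))) ->
  normal_span a c m (x2 * (x2 * (x1 * w))).
Proof.
apply: normal_span_mod; move: (tgw_idealMr J_ideal w s2J).
by rewrite !mulrBl -!tgw_scaleAl !expr2 !mulrA opprD addrA.
Qed.

(** Read s1 and s2 as rewriting rules for x2 x1 x1 and x2 x2 x1.  A normal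
    monomial multiplied by x2 either is normal again or starts with one of these
    words, and each term of the right-hand side is then handled by induction on
    the total degree a + c.  One term escapes this: rewriting x2 x2 x1 w, which
    arises for b = a, leaves x2 (x1 x2 w) of the same total degree.  There
    x1 x2 w has only indices b' < a, so the case b < a is proved first. *)
Lemma X2_normal_mono a c b : (b <= a)%N -> (b <= c)%N ->
  normal_span a c.+1 (minn a c.+1) (x2 * normal_mono a c b).
Proof.
have [n] := ubnP (a + c); elim: n => // n IHn in a c b * => acn ba bc.
have IH a' c' m z : (a' + c' < a + c)%N -> (m <= a')%N -> (m <= c')%N ->
    normal_span a' c' m z -> normal_span a' c'.+1 (minn a' c'.+1) (x2 * z).
  move=> lt ma mc; apply: (normal_span_mull (tgwXr D ord_max)) => b' b'm.
  by apply: IHn; [apply: leq_trans lt _|apply: leq_trans b'm _..].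
have caselt b' : (b' < a)%N -> (b' <= c)%N ->
    normal_span a c.+1 (minn a c.+1) (x2 * normal_mono a c b').
  clear b ba bc; move=> b'a b'c; case: a => // a in acn IH b'a *.
  have [eb'|b'neq] := eqVneq b' a.
    rewrite {}eb' in b'c *.
    have -> : x2 * normal_mono a.+1 c a = normal_mono a.+1 c.+1 a.+1.
      by rewrite /normal_mono subSnn subnn subSS expr0 expr1 mul1r exprS !mulrA.
    by apply: normal_span_mono; rewrite leq_min !ltnS leqnn b'c.
  case: a => [|a] in acn IH b'a b'neq *; first by case: b' {b'c} b'a b'neq.
  have {b'neq}b'a' : (b' <= a)%N.
    by move: b'a; rewrite ltnS leq_eqVlt (negPf b'neq).
  rewrite -normal_monoX1 ?leqW // -normal_monoX1 //; apply: serre1.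
  apply: normal_spanD; apply: normal_spanZ.
    apply: (normal_span_widen (m := minn a.+1 c.+1)).
      by rewrite leq_min geq_minr (leq_trans (geq_minl _ _)).
    apply: normal_spanX1; first exact: geq_minl.
    apply: (IH a.+1 c b') => //.
    by rewrite normal_monoX1 //; apply: normal_span_mono.
  apply: (normal_span_widen (m := minn a c.+1)).
    by rewrite leq_min geq_minr !(leq_trans (geq_minl _ _)) // leqW.
  apply: normal_spanX1; first by rewrite (leq_trans (geq_minl _ _)).
  apply: normal_spanX1; first exact: geq_minl.
  by apply: (IH a c b') => //; apply: normal_span_mono.
case: (ltnP b a) => [ltba|leab]; first exact: caselt.
have {ba leab}eba : b = a by apply/eqP; rewrite eqn_leq ba.
rewrite {b}eba in bc *.
case: a => [|b] in acn IH caselt bc *.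
  have -> : x2 * normal_mono 0 c 0 = normal_mono 0 c.+1 0.
    by rewrite /normal_mono !subn0 !mul1r exprS.
  by apply: normal_span_mono.
case: c => // c in acn IH caselt bc *.
have -> : x2 * normal_mono b.+1 c.+1 b.+1
    = x2 * (x2 * (x1 * normal_mono b c b)).
  by rewrite /normal_mono !subSS subnn !mul1r exprS !mulrA.
apply: serre2; set w := normal_mono b c b.
have x2w : normal_span b c.+1 b (x2 * w).
  apply: (normal_span_widen (geq_minl b c.+1)).
  apply: (IH b c b) => //; last exact: normal_span_mono.
  by rewrite addSnnS ltn_add2l leqW.
apply: normal_spanD; apply: normal_spanZ.
  apply: (normal_span_mull (tgwXr D ord_max)) (normal_spanX1 _ x2w) => //.
  move=> b' b'b.
  by apply: caselt => //; rewrite (leq_trans b'b) // ltnW.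
apply: (normal_span_widen (m := minn b c.+2)).
  by rewrite leq_min geq_minr (leq_trans (geq_minl _ _)).
apply: normal_spanX1; first exact: geq_minl.
by apply: (IH b c.+1 b) => //; rewrite ltnW.
Qed.

Lemma wordX_normal_span (v : seq 'I_2) :
  let a := count_mem ord0 v in let c := count_mem ord_max v in
  normal_span a c (minn a c) (wordX D v).
Proof.
elim: v => [|i v IHv] /=.
  rewrite wordX_nil (_ : 1 = normal_mono 0 0 0); first exact: normal_span_mono.
  by rewrite /normal_mono !mulr1.
rewrite wordX_cons; case: (ord2P i) => -> /=; rewrite add0n add1n.
  apply: (normal_span_widen
    (m := minn (count_mem ord0 v) (count_mem ord_max v))).
    by rewrite leq_min geq_minr (leq_trans (geq_minl _ _)).
  by apply: normal_spanX1 IHv; apply: geq_minl.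
apply: (normal_span_mull (tgwXr D ord_max)) IHv => b.
by rewrite leq_min => /andP[]; apply: X2_normal_mono.
Qed.

End Spanning.

(** * The top coefficient of a combination that acts as zero *)

Context (R_domain : GRing.integral_domain_axiom R).
Context (sigma_t1_cancel : forall (k : nat) (r : R), (0 < k)%N ->
  (exists c : R, r * \prod_(1 <= i < k.+1) iter i (sigma1 \o sigma2) t1
     = c * sigma1 t1) ->
  exists c : R, r = c * sigma1 t1).

Lemma iter_rmorphM (f : {lrmorphism R -> R}) n u v :
  iter n f (u * v) = iter n f u * iter n f v.
Proof. by elim: n => //= n ->; rewrite rmorphM. Qed.

Lemma iter_rmorphD (f : {lrmorphism R -> R}) n u v :
  iter n f (u + v) = iter n f u + iter n f v.
Proof. by elim: n => //= n ->; rewrite rmorphD. Qed.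

Lemma iter_rmorph0 (f : {lrmorphism R -> R}) n : iter n f 0 = 0.
Proof. by elim: n => //= n ->; rewrite rmorph0. Qed.

Lemma iter_linearZ (f : {lrmorphism R -> R}) n (k : K) u :
  iter n f (k *: u) = k *: iter n f u.
Proof. by elim: n => //= n ->; rewrite linearZ. Qed.

Lemma iterC (f g : R -> R) n u :
  (forall z, f (g z) = g (f z)) -> iter n f (g u) = g (iter n f u).
Proof. by move=> fg; elim: n => //= n ->. Qed.

Lemma iter_cancel (f g : R -> R) n : cancel f g -> cancel (iter n f) (iter n g).
Proof. by move=> fK; elim: n => // n IHn u; rewrite iterSr iterS fK IHn. Qed.

Lemma iter_comp (f g : R -> R) n u : (forall z, f (g z) = g (f z)) ->
  iter n (f \o g) u = iter n f (iter n g u).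
Proof.
by move=> fg; elim: n => //= n ->; rewrite -(iterC n (iter n g u)).
Qed.

Lemma expr_twistr (x : tgwc D) (f : R -> R) n r :
  (forall r, x * r_ r = r_ (f r) * x) ->
  x ^+ n * r_ r = r_ (iter n f r) * x ^+ n.
Proof.
move=> xf; elim: n => [|n IHn]; first by rewrite mul1r mulr1.
by rewrite exprS -mulrA IHn mulrA xf mulrA.
Qed.

Lemma y1_x2n n : exists2 k : K, k != 0 & y1 * x2 ^+ n = k *: (x2 ^+ n * y1).
Proof.
elim: n => [|n [k k0 e]].
  by exists 1; rewrite ?oner_neq0 // mul1r mulr1 scale1r.
exists ((tgw_mu D ord_max ord0)^-1 * k).
  by rewrite mulf_neq0 ?invr_neq0 ?tgw_mu_neq0.
rewrite exprS mulrA tgwYXmu // -tgw_scaleAl -!mulrA e -tgw_scaleAr scalerA.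
by rewrite mulrA.
Qed.

(** Each y1 passes the x2 to its right, up to scalars, and turns its x1 into t1.
    The resulting factor is described by its image under sigma1^n because the
    coefficient collected at step i is sigma1^(i-n) sigma2^i (t1), whose image
    is tau^i (t1). *)
Lemma y1n_En n : exists k p, [/\ k != 0 :> K,
  iter n sigma1 p = k *: \prod_(1 <= i < n.+1) iter i (sigma1 \o sigma2) t1
  & y1 ^+ n * (x2 * x1) ^+ n = r_ p * x2 ^+ n].
Proof.
elim: n => [|n [k [p [k0 pE e]]]].
  by exists 1, 1; rewrite oner_neq0 big_geq // scale1r rmorph1.
have [k' k'0 e'] := y1_x2n n.+1.
exists (k' * k), (k' *: (sigmaV1 p * iter n.+1 sigma2 t1)); split.
- by rewrite mulf_neq0.
- rewrite big_nat_recr //= -iterS iter_linearZ iter_rmorphM iterSr.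
  rewrite tgw_sigmaVK pE.
  rewrite -scalerAl scalerA (iter_comp _ _ (tgw_sigmaC D ord0 ord_max)).
  by rewrite (iterC _ _ (tgw_sigmaC D ord0 ord_max)) -tgw_sigmaC.
rewrite exprS exprSr -!mulrA (mulrA (y1 ^+ n)) e -!mulrA (mulrA _ x2 x1).
rewrite -exprSr mulrA tgwYr -mulrA (mulrA y1) e' -tgw_scaleAl -mulrA tgwYX.
rewrite (expr_twistr _ _ (tgwXr D ord_max)) -tgw_scaleAr mulrA -rmorphM.
by rewrite tgw_scaleAl -tgwRZ.
Qed.

Lemma y1n_x1k n k : exists g, y1 ^+ (n + k) * x1 ^+ k = r_ g * y1 ^+ n.
Proof.
elim: k => [|k [g e]]; first by exists 1; rewrite addn0 mulr1 rmorph1 mul1r.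
exists (iter (n + k) sigmaV1 t1 * g).
rewrite addnS exprSr exprS -mulrA (mulrA y1) tgwYX mulrA.
by rewrite (expr_twistr _ _ (tgwYr D ord0)) -mulrA e mulrA -rmorphM.
Qed.

Lemma y1n_normal_mono m c b : (b <= m)%N -> (b <= c)%N ->
  exists g, y1 ^+ m * normal_mono m c b = r_ g * x2 ^+ c.
Proof.
move=> bm bc; have [g e] := y1n_x1k b (m - b).
have [k [p [_ _ e']]] := y1n_En b.
exists (g * p); rewrite /normal_mono -{1}(subnKC bm) 2!mulrA e.
by rewrite -[r_ g * _ * _]mulrA e' rmorphM -!mulrA -exprD subnKC.
Qed.

(** A normal monomial with index b <= m in degree (m + 1, c) starts with x1,
    which meets the last y1; moving the resulting t1 to the left across y1^m
    gives the common factor. *)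
Lemma y1n_lower_sum m c (r : nat -> R) n : (n <= m.+1)%N -> (m < c)%N ->
  exists G, y1 ^+ m.+1 * (\sum_(b < n) r_ (r b) * normal_mono m.+1 c b)
    = r_ (iter m sigmaV1 t1 * G) * x2 ^+ c.
Proof.
move=> + mc; elim: n => [|n IHn] nm.
  by exists 0; rewrite big_ord0 !mulr0 rmorph0 mul0r.
have [G e] := IHn (ltnW nm); rewrite ltnS in nm.
have [g eg] := y1n_normal_mono nm (leq_trans nm (ltnW mc)).
exists (G + iter m.+1 sigmaV1 (r n) * g).
rewrite big_ord_recr mulrDr e mulrDr rmorphD mulrDl; congr (_ + _) => /=.
rewrite mulrA (expr_twistr _ _ (tgwYr D ord0)) -normal_monoX1 //.
rewrite exprSr -!mulrA (mulrA y1) tgwYX (mulrA (y1 ^+ m)).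
rewrite (expr_twistr _ _ (tgwYr D ord0)).
by rewrite -!mulrA eg !mulrA -!rmorphM /= [_ * sigmaV1 _]mulrC.
Qed.

(** Multiplying by y1^(m+1) and cancelling x2^c leaves one equation in R.  Its
    image under sigma1^(m+1) says that sigma1 t1 divides
    r_(m+1) tau(t1) ... tau^(m+1)(t1). *)
Lemma top_coef m c (r : nat -> R) : (m < c)%N ->
  act_ker (\sum_(b < m.+2) r_ (r b) * normal_mono m.+1 c b) ->
  exists c', r m.+1 = c' * sigma1 t1.
Proof.
move=> mc; rewrite big_ord_recr /=.
move=> /(tgw_idealMl (act_ker_ideal D) (y1 ^+ m.+1)).
have [G e] := y1n_lower_sum r (leqnn _) mc.
have [k [p [k0 pE e']]] := y1n_En m.+1.
rewrite mulrDr e mulrA (expr_twistr _ _ (tgwYr D ord0)) /normal_mono subnn.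
rewrite mul1r -mulrA (mulrA (y1 ^+ _)) e' -[r_ p * _ * _]mulrA -exprD subnKC //.
rewrite mulrA -rmorphM -mulrDl -rmorphD => /(tgwR_mul_act_ker R_domain).
have inj : act_injective (x2 ^+ c) by apply/act_injectiveXn/act_injectiveX.
move=> /(_ inj) /(congr1 (iter m.+1 sigma1)).
rewrite iter_rmorphD !iter_rmorphM iter_rmorph0 pE.
rewrite [iter m.+1 sigma1 (iter m sigmaV1 _)]iterS.
rewrite !(iter_cancel _ (tgw_sigmaVK D ord0)).
set G' := iter _ _ G => /eqP; rewrite addrC addr_eq0 -scalerAr => /eqP rP.
apply: (@sigma_t1_cancel m.+1) => //; exists (- (k^-1 *: G')).
rewrite mulNr -scalerAl mulrC [G' * _]mulrC -scalerN -rP scalerA mulVf //.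
by rewrite scale1r mulrC.
Qed.

(** Both sides equal x1 y1 x2 x1, since sigma1(t1) = x1 y1 and y1 passes x2 up
    to the scalar. *)
Lemma sigma_t_X2X1 : r_ (sigma1 t1) * (x2 * x1)
  = (tgw_mu D ord_max ord0)^-1 *: (r_ (sigma1 (sigma2 t1)) * (x1 * x2)).
Proof.
rewrite -tgwXY -mulrA (mulrA y1) tgwYXmu // -!tgw_scaleAl -tgw_scaleAr.
by rewrite -(mulrA x2) tgwYX tgwXr 2!mulrA tgwXr -mulrA.
Qed.

(** * Descent on the top index *)

Context (J : set (tgwc D)) (J_ideal : tgw_ideal J).
Context (J_act_ker : forall a, J a -> act_ker a).
Context (xi1 xi2 eta1 eta2 : K).
Context (s1J :
  J (x2 * x1 ^+ 2 - xi1 *: (x1 * x2 * x1) - xi2 *: (x1 ^+ 2 * x2))).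
Context (s2J :
  J (x2 ^+ 2 * x1 - eta1 *: (x2 * x1 * x2) - eta2 *: (x1 * x2 ^+ 2))).

(** Trading sigma1(t1) x2 x1 for tau(t1) x1 x2 leaves x1 times x2 (x2 x1)^m.  The
    second factor has degree (m, m + 1), so its normal monomials have indices at
    most m, and multiplying by x1 on the left and by powers of x2 on the right
    does not change the indices. *)
Lemma top_normal_span m c s : (m < c)%N ->
  normal_span J m.+1 c m (r_ (s * sigma1 t1) * normal_mono m.+1 c m.+1).
Proof.
move=> mc; rewrite rmorphM -mulrA; apply: normal_spanR => //.
rewrite /normal_mono subnn mul1r exprS !mulrA -mulrA -(mulrA _ x2 x1).
rewrite sigma_t_X2X1 -!tgw_scaleAl; apply: normal_spanZ => //; rewrite -!mulrA.
apply: normal_spanR => //; rewrite mulrA mulrA -(mulrA x1).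
rewrite -{1}(subnK mc); apply: normal_spanX2nr => //.
apply: normal_spanX1 => //.
apply: (normal_span_widen J_ideal (geq_minl m m.+1)).
have -> : (x2 * x1) ^+ m = normal_mono m m m.
  by rewrite /normal_mono subnn mul1r mulr1.
exact: (X2_normal_mono J_ideal s1J s2J).
Qed.

Lemma act_ker_congr x y : J (x - y) -> act_ker x -> act_ker y.
Proof.
move=> Jxy kx; rewrite -[y](subKr x).
exact: (tgw_idealB (act_ker_ideal D)) kx (J_act_ker Jxy).
Qed.

Lemma act_ker_normal_sum m a c (r : nat -> R) : (m <= a)%N -> (m <= c)%N ->
  act_ker (\sum_(b < m.+1) r_ (r b) * normal_mono a c b) ->
  J (\sum_(b < m.+1) r_ (r b) * normal_mono a c b).
Proof.
elim: m r => [|m IHm] r ma mc.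
  rewrite big_ord_recr /= big_ord0 add0r => /(tgwR_mul_act_ker R_domain) ->.
    by rewrite rmorph0 mul0r; apply: tgw_ideal0.
  rewrite /normal_mono mulr1.
  by apply: act_injectiveM; apply/act_injectiveXn/act_injectiveX.
(* The common left factor x1^j can be cancelled, as x1 acts injectively. *)
pose j := (a - m.+1)%N; pose s b := iter j sigmaV1 (r b).
have -> : \sum_(b < m.+2) r_ (r b) * normal_mono a c b
    = x1 ^+ j * \sum_(b < m.+2) r_ (s b) * normal_mono m.+1 c b.
  rewrite mulr_sumr; apply: eq_bigr => b _.
  rewrite mulrA (expr_twistr _ _ (tgwXr D ord0)) /s.
  rewrite (iter_cancel _ (tgw_sigmaVK D ord0)) -mulrA /normal_mono.
  rewrite !(mulrA (x1 ^+ j)) -exprD addnBA ?subnK //.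
  by rewrite -ltnS.
set z := \sum_(b < _) _ => kz.
have inj : act_injective (x1 ^+ j) by apply/act_injectiveXn/act_injectiveX.
have {}kz := act_ker_cancel inj kz.
have [c' sc'] := top_coef mc kz.
have [r' Jr'] : normal_span J a c m (x1 ^+ j * z).
  rewrite -{1}(subnK ma); apply: normal_spanX1n => //.
  rewrite /z big_ord_recr /= sc'.
  apply: normal_spanD => //; last exact: top_normal_span.
  apply: normal_span_sum => // b; apply: normal_spanR => //.
  by apply: normal_span_mono => //; rewrite -ltnS.
rewrite -[x1 ^+ j * z](subrK (\sum_(b < m.+1) r_ (r' b) * normal_mono a c b)).
apply: tgw_idealD => //; apply: IHm; rewrite 1?ltnW //.
by apply: act_ker_congr Jr' _; apply: (tgw_idealMl (act_ker_ideal D)).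
Qed.

Lemma homog_ge0_act_ker d a : tgw_homog d a -> (forall j, 0 <= d 0 j) ->
  act_ker a -> J a.
Proof.
move=> ha d0 ka; pose e (j : 'I_2) := absz (d 0 j).
have [r Jr] : normal_span J (e ord0) (e ord_max) (minn (e ord0) (e ord_max)) a.
  elim: (homog_reduced_span ha) => [|x y _ IHx _ IHy|r u v uv duv].
  - exact/normal_span_ideal/(tgw_ideal0 J_ideal).
  - exact: normal_spanD.
  have u0 : u = [::].
    by apply: notin_nil => j; apply: reduced_degree_ge0 uv _; rewrite duv.
  apply: normal_spanR => //; rewrite {}u0 wordY_nil mul1r in duv *.
  have eE j : e j = count_mem j v.
    rewrite /e -duv /word_degree big_nil subr0 -/(word_degree v).
    by rewrite word_degreeE.
  by rewrite !eE; apply: (wordX_normal_span J_ideal s1J s2J).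
rewrite -[a](subrK (\sum_(b < (minn (e ord0) (e ord_max)).+1)
  r_ (r b) * normal_mono (e ord0) (e ord_max) b)).
apply: tgw_idealD => //.
apply: act_ker_normal_sum; [exact: geq_minl|exact: geq_minr|].
exact: act_ker_congr Jr _.
Qed.

(** In a mixed degree the only reduced monomial is a power of y_j times a power
    of x_i. *)
Lemma homog_mixed_act_ker (d : 'rV[int]_2) (a : tgwc D) i j :
  tgw_homog d a -> i != j -> 0 <= d 0 i -> d 0 j <= 0 -> act_ker a -> a = 0.
Proof.
move=> ha ij di dj.
have only (k l : 'I_2) (w : seq 'I_2) :
    k != l -> k \notin w -> w = nseq (count_mem l w) l.
  move=> kl kw; have wl : all (pred1 l) w.
    apply/allP => b bw; move: kl; have : b != k by apply: contraNneq kw => <-.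
    by case: (ord2P k) => ->; case: (ord2P l) => ->; case: (ord2P b) => ->.
  by move: (wl); rewrite all_count => /eqP ->; apply/all_pred1P.
have [r ->] : exists r, a = r_ r *
    (wordY D (nseq (absz (d 0 j)) j) * wordX D (nseq (absz (d 0 i)) i)).
  elim: (homog_reduced_span ha) => [|x y _ [r ->] _ [s ->]|r u v uv duv].
  - by exists 0; rewrite rmorph0 mul0r.
  - by exists (r + s); rewrite rmorphD mulrDl.
  have iu : i \notin u by apply: reduced_degree_ge0 uv _; rewrite duv.
  have jv : j \notin v by apply: reduced_degree_le0 uv _; rewrite duv.
  exists r; rewrite -duv !mxE !word_degreeE (count_memPn iu) (count_memPn jv).
  by rewrite subr0 sub0r abszN /= -(only i j u) // -(only j i v) // eq_sym.
move/(tgwR_mul_act_ker R_domain) => ->; first by rewrite rmorph0 mul0r.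
apply: act_injectiveM; [exact: act_injective_wordY|exact: act_injective_wordX].
Qed.

End NormalForms.

(** * The theorem *)

Theorem theorem6p1 (K : fieldType) (R : comAlgType K) (D : tgw_datum R 2)
    (R_domain : GRing.integral_domain_axiom R)
    (sigma1 := tgw_sigma D ord0) (sigma2 := tgw_sigma D ord_max)
    (t1 := tgw_t D ord0)
    (X1 := tgwX D ord0) (X2 := tgwX D ord_max)
    (P1 : forall (k : nat) (r : R), (0 < k)%N ->
      (exists c : R,
        r * \prod_(1 <= i < k.+1) iter i (sigma1 \o sigma2) t1
          = c * sigma1 t1) ->
      exists c : R, r = c * sigma1 t1)
    (xi1 xi2 eta1 eta2 : K)
    (xi1_neq0 : xi1 != 0) (xi2_neq0 : xi2 != 0)
    (eta1_neq0 : eta1 != 0) (eta2_neq0 : eta2 != 0)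
    (s1 := X2 * X1 ^+ 2 - xi1 *: (X1 * X2 * X1) - xi2 *: (X1 ^+ 2 * X2))
    (s2 := X2 ^+ 2 * X1 - eta1 *: (X2 * X1 * X2) - eta2 *: (X1 * X2 ^+ 2))
    (s1_in_I : tgw_I D s1) (s2_in_I : tgw_I D s2) :
  tgw_I D = tgw_ideal_gen [set s1; s2; tgw_star s1; tgw_star s2].
Proof.
set S := [set s1; s2; tgw_star s1; tgw_star s2]; set G := tgw_ideal_gen S.
have GI : tgw_ideal G by apply: ideal_gen_ideal.
have SG : S `<=` G by apply: sub_ideal_gen.
have s1G : G s1 by apply: SG; left; left; left.
have s2G : G s2 by apply: SG; left; left; right.
have subI : G `<=` tgw_I D.
  apply: smallest_sub; first exact: tgw_I_ideal.
  by move=> _ [[[->|->]|->]|->] //; apply: tgw_I_star.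
have starG a : G a -> G (tgw_star a).
  move: a; apply: smallest_sub; first exact: star_ideal.
  move=> _ [[[->|->]|->]|->] /=; rewrite ?tgw_starK //; apply: SG; [|by right].
  by left; right.
have kerI a : tgw_I D a -> act_ker a.
  apply: tgw_I_ind => [|x y|J b d [JI _ JR] Jb hb].
  - exact: (tgw_ideal0 (act_ker_ideal D)).
  - exact: (tgw_idealD (act_ker_ideal D)).
  - exact: (homog_act_ker R_domain JI JR hb Jb).
have kerG a : G a -> act_ker a by move/subI/kerI.
apply/seteqP; split=> //; apply: tgw_I_ind => [|x y|J a d Joff Ja ha].
- exact: tgw_ideal0.
- exact: tgw_idealD.
have ka : act_ker a.
  by case: Joff => JI _ JR; apply: (homog_act_ker R_domain JI JR ha Ja).
have ge0 e b : tgw_homog e b -> (forall j, 0 <= e 0 j) -> act_ker b -> G b.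
  exact: (homog_ge0_act_ker R_domain P1 GI kerG s1G s2G).
have mixed i j : i != j -> 0 <= d 0 i -> d 0 j <= 0 -> G a.
  move=> ij di dj; rewrite (homog_mixed_act_ker R_domain ha ij di dj ka).
  exact: tgw_ideal0.
have [d0|d0] := leP 0 (d 0 ord0); have [d1|d1] := leP 0 (d 0 ord_max).
- by apply: ge0 ha _ ka => j; case: (ord2P j) => ->.
- by apply: (mixed ord0 ord_max) => //; apply: ltW.
- by apply: (mixed ord_max ord0) => //; apply: ltW.
rewrite -[a]tgw_starK; apply: starG; apply: ge0 (tgw_star_homog ha) _ _.
  by move=> j; rewrite mxE oppr_ge0; case: (ord2P j) => ->; apply: ltW.
have [JI _ JR] := star_graded_off_R Joff.
apply: (homog_act_ker R_domain JI JR (tgw_star_homog ha)).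
by rewrite /= tgw_starK.
Qed.
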